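(* Let $Q$ be a finite quiver with vertex set $I$, and let $d,n\in\mathbf{N}I$ be dimension vectors with $n\neq0$. Then $\mathrm{H}_{d,n}(Q)$ is non-empty if and only if the following two conditions hold: 1. $n_i-\langle d,i\rangle\ge0$ for all $i\in I$; 2. for any $i\in I$ such that $d_i\neq0$, there exists a vertex $j$ such that $n_j\neq0$ and such that there exists a path (possibly of length zero) in $\mathrm{supp}(d)$ from $j$ to $i$.
   Context: Euler form: $\langle d,e\rangle=\sum_{i\in I}d_ie_i-\sum_{\alpha:i\to j}d_ie_j$; a vertex $i\in I$ is viewed as the corresponding unit vector in $\mathbf{N}I$, so $\langle d,i\rangle=d_i-\sum_{\alpha:j\to i}d_j$. The support $\mathrm{supp}(d)$ is the full subquiver of $Q$ on the vertices $i$ with $d_i\ne0$. $\mathrm{H}_{d,n}(Q)$ (the smooth model $M_{d,n}^0(Q)$ for trivial stability $\Theta=0$, called the Hilbert scheme of the path algebra): fix complex vector spaces $M_i$, $V_i$ of dimensions $d_i$, $n_i$; $\mathrm{H}_{d,n}(Q)$ is the geometric quotient by $G_d=\prod_i\mathrm{GL}(M_i)$ (acting by base change) of the open subset of $\bigoplus_{\alpha:i\to j}\mathrm{Hom}(M_i,M_j)\oplus\bigoplus_i\mathrm{Hom}(V_i,M_i)$ consisting of pairs $(M,f)$ such that the image of $f=(f_i:V_i\to M_i)_i$ generates the representation $M$ (no proper subrepresentation of $M$ contains all $f_i(V_i)$). Its points are thus the isomorphism classes of such pairs $(M,f)$. *)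

(* Defs.v *)
From mathcomp Require Import all_boot all_order all_algebra.
From mathcomp Require Import classical_sets reals complex.

Set Implicit Arguments.
Unset Strict Implicit.
Unset Printing Implicit Defensive.
Import Order.TTheory GRing.Theory Num.Theory.
Local Open Scope ring_scope.
Local Open Scope classical_set_scope.

Record quiver := Quiver {
  vertex : finType;
  arrow : finType;
  src : arrow -> vertex;
  tgt : arrow -> vertex }.
Arguments src {q} _.
Arguments tgt {q} _.

Definition full_subquiver (Q : quiver) (P : pred (vertex Q)) : quiver :=
  @Quiver {i : vertex Q | P i}
    {a : arrow Q | P (src a) && P (tgt a)}
    (fun a => exist _ (src (val a)) (proj1 (andP (valP a))))
    (fun a => exist _ (tgt (val a)) (proj2 (andP (valP a)))).

(* [is_qpath i p j]: the arrows of p, in the order in which they are followed,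
   form a path from i to j; the empty sequence is the path of length zero. *)
Fixpoint is_qpath (Q : quiver) (i : vertex Q) (p : seq (arrow Q))
    (j : vertex Q) : bool :=
  if p is a :: p' then (src a == i) && is_qpath (tgt a) p' j else i == j.

Notation dimvec Q := {ffun vertex Q -> nat}.

Definition unitvec (Q : quiver) (i : vertex Q) : dimvec Q :=
  [ffun j => nat_of_bool (j == i)].

Definition euler (Q : quiver) (d e : dimvec Q) : int :=
  \sum_(i : vertex Q) (d i)%:Z * (e i)%:Z
  - \sum_(a : arrow Q) (d (src a))%:Z * (e (tgt a))%:Z.

Definition supp (Q : quiver) (d : dimvec Q) : quiver :=
  full_subquiver (fun i => d i != 0%N).

Section Hilbert.
Variables (F : fieldType) (Q : quiver) (d n : dimvec Q).

(* M_i = F^(d i) and V_i = F^(n i) are spaces of row vectors, on which matrices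
   act from the right. *)
Record framed_rep := FramedRep {
  rep_arrow : forall a : arrow Q, 'M[F]_(d (src a), d (tgt a));
  rep_frame : forall i : vertex Q, 'M[F]_(n i, d i) }.

(* The matrix U i stands for the subspace of M_i spanned by its rows. *)
Definition subrep (x : framed_rep) (U : forall i : vertex Q, 'M[F]_(d i)) :=
  forall a : arrow Q, (U (src a) *m rep_arrow x a <= U (tgt a))%MS.

Definition generated : set framed_rep :=
  [set x | forall U : forall i : vertex Q, 'M[F]_(d i),
     subrep x U -> (forall i, (rep_frame x i <= U i)%MS) ->
     forall i, row_full (U i)].

Definition base_group : set (forall i : vertex Q, 'M[F]_(d i)) :=
  [set g | forall i, g i \in unitmx].

Definition base_change (x : framed_rep) (g : forall i : vertex Q, 'M[F]_(d i)) :
    framed_rep :=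
  FramedRep (fun a => invmx (g (src a)) *m rep_arrow x a *m g (tgt a))
            (fun i => rep_frame x i *m g i).

Definition base_orbit (x : framed_rep) : set framed_rep :=
  base_change x @` base_group.

(* The geometric quotient is represented by its set of points: the orbits of
   the base change action on the generated locus. *)
Definition hilb : set (set framed_rep) := base_orbit @` generated.

End Hilbert.
Arguments hilb F {Q} d n.

(* Main.v *)
Require Import Defs.
From mathcomp Require Import all_boot all_order all_algebra.
From mathcomp Require Import boolp classical_sets reals complex zify.

Set Implicit Arguments.
Unset Strict Implicit.
Unset Printing Implicit Defensive.
Import Order.TTheory GRing.Theory Num.Theory.
Local Open Scope ring_scope.
Local Open Scope classical_set_scope.

(** Necessity: if the framed representation is generated, then for each vertex
    [i] the images of the framing and of the arrows into [i] span [M_i], which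
    bounds [d i]; and the subspaces that are everything at the vertices
    reachable in [supp d] from the framing and zero elsewhere form a
    subrepresentation containing the framing.

    Sufficiency: there is a tree-like representation, in which every basis
    vector is either the image of a basis vector of the framing or the image
    under an arrow of an earlier basis vector.  Such forests are grown greedily,
    one basis vector at a time, inside [d].  Suppose that a forest of dimension
    vector [e < d] cannot be extended, so that
    [e i = n i + \sum_(a : j -> i) e j] at every [i] of
    [S = {i | e i < d i}].  By (1) every [i] in [S] has a predecessor in [S].
    Let [m] be the minimum of [e] on [S], attained on [T].  Every [i] in [T]
    then has [n i = 0] and a predecessor in [T], all other arrows into [i]
    starting where [e] vanishes.  If [m > 0], the basis vectors over [T] cannot
    be generated from the framing; if [m = 0], [T] is closed under predecessors
    in [supp d] and carries no framing, against (2). *)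

(** * The Euler form at a unit vector *)

Lemma euler_unitvec (Q : quiver) (d : dimvec Q) (i : vertex Q) :
  euler d (unitvec i) =
  (d i)%:Z - (\sum_(a : arrow Q | tgt a == i) d (src a))%N%:Z.
Proof.
rewrite /euler (bigD1 i) //= ffunE eqxx mulr1 big1 ?addr0 => [|j ji]; last first.
  by rewrite ffunE (negPf ji) mulr0.
congr (_ - _); rewrite -natz natr_sum [RHS]big_mkcond /=.
by apply: eq_bigr => a _; rewrite ffunE natz; case: eqP; rewrite ?mulr1 ?mulr0.
Qed.

Lemma euler_condE (Q : quiver) (d n : dimvec Q) (i : vertex Q) :
  (0 <= (n i)%:Z - euler d (unitvec i)) =
  (d i <= n i + \sum_(a : arrow Q | tgt a == i) d (src a))%N.
Proof. by rewrite euler_unitvec opprB addrA subr_ge0 -PoszD lez_nat. Qed.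

(** * Paths in the support *)

Lemma is_qpath_rcons (Q : quiver) (i : vertex Q) (p : seq (arrow Q)) (a : arrow Q) :
  is_qpath i p (src a) -> is_qpath i (rcons p a) (tgt a).
Proof.
elim: p i => [|b p IHp] i /=; first by move=> /eqP ->; rewrite !eqxx.
by move=> /andP[-> /IHp].
Qed.

Section Reachability.
Variables (Q : quiver) (d n : dimvec Q).

Definition reachable (i : vertex Q) (di : d i != 0%N) : Prop :=
  exists (j : vertex Q) (dj : d j != 0%N),
    n j != 0%N /\
    exists p : seq (arrow (supp d)),
      is_qpath (exist _ j dj : vertex (supp d)) p
               (exist _ i di : vertex (supp d)).

Lemma reachable_frame (i : vertex Q) (di : d i != 0%N) :
  n i != 0%N -> reachable di.
Proof. by move=> ni; exists i, di; split=> //; exists [::]; rewrite /= eqxx. Qed.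

Lemma reachable_arrow (a : arrow Q) (ds : d (src a) != 0%N) (dt : d (tgt a) != 0%N) :
  reachable ds -> reachable dt.
Proof.
move=> [j [dj [nj [p jp]]]]; exists j, dj; split=> //.
have da : (d (src a) != 0%N) && (d (tgt a) != 0%N) by rewrite ds dt.
pose b : arrow (supp d) := exist _ a da.
have sb : src b = exist _ (src a) ds by apply: val_inj.
have tb : tgt b = exist _ (tgt a) dt by apply: val_inj.
by exists (rcons p b); rewrite -tb; apply: is_qpath_rcons; rewrite sb.
Qed.

Lemma reachable_ind (P : vertex Q -> Prop) :
  (forall i, d i != 0%N -> n i != 0%N -> P i) ->
  (forall a : arrow Q, d (src a) != 0%N -> d (tgt a) != 0%N ->
     P (src a) -> P (tgt a)) ->
  forall (i : vertex Q) (di : d i != 0%N), reachable di -> P i.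
Proof.
move=> Pframe Parrow i di [j [dj [nj [p]]]].
suff path_ind (v w : vertex (supp d)) : is_qpath v p w -> P (val v) -> P (val w).
  by move=> /path_ind; apply; apply: Pframe.
elim: p v => [|a p IHp] v /=; first by move=> /eqP ->.
move=> /andP[/eqP <- aw Pa]; apply: IHp aw _; case/andP: (valP a) => sa ta.
exact: (Parrow (val a)).
Qed.

End Reachability.

(** * Necessity of the two conditions *)

Section Necessity.
Variables (F : fieldType) (Q : quiver) (d n : dimvec Q).
Variables (x : framed_rep F d n) (xgen : generated x).

Lemma generated_dim_le (i : vertex Q) :
  (d i <= n i + \sum_(a : arrow Q | tgt a == i) d (src a))%N.
Proof.
(* [conform_mx] retypes the arrow matrix along [tgt a == j]; its default 0 is never reached in this
   sum. *)
pose U j : 'M[F]_(d j) := (<<rep_frame x j>> + \sum_(a : arrow Q | tgt a == j)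
  <<conform_mx (0 : 'M_(d (src a), d j)) (rep_arrow x a)>>)%MS.
have /eqP <- : row_full (U i).
  apply: xgen => [a|j]; last first.
    by apply: submx_trans (addsmxSl _ _); rewrite genmxE.
  apply: submx_trans (submxMl _ _) _; apply: submx_trans (addsmxSr _ _).
  by apply: (sumsmx_sup a) => //; rewrite conform_mx_id genmxE.
apply: leq_trans (mxrank_adds_leqif _ _) _; apply: leq_add.
  by rewrite genmxE rank_leq_row.
apply: leq_trans (mxrank_sum_leqif _) _ => /=.
by apply: leq_sum => a _; rewrite genmxE rank_leq_row.
Qed.

Lemma generated_reachable (i : vertex Q) (di : d i != 0%N) : reachable n di.
Proof.
(* Where [d j] is 0 the condition is vacuous, and [U j] is the whole (zero) space. *)
pose U j : 'M[F]_(d j) :=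
  if `[< forall dj : d j != 0%N, reachable n dj >] then 1%:M else 0.
have fullU : row_full (U i).
  apply: xgen => [a|j]; rewrite /U.
    case: asboolP => [ra|_]; last by rewrite mul0mx sub0mx.
    case: asboolP => [_|nrt]; first by rewrite submx1.
    suff rx0 : rep_arrow x a = 0 by rewrite rx0 mulmx0 sub0mx.
    have [ds|ds] := eqVneq (d (src a)) 0%N.
      by apply/matrixP => k; have := ltn_ord k; rewrite [X in (_ < X)%N]ds.
    by case: nrt => dt; apply: reachable_arrow (ra ds).
  case: asboolP => [_|nr]; first by rewrite submx1.
  suff rx0 : rep_frame x j = 0 by rewrite rx0 sub0mx.
  apply/matrixP => -[k kn]; case: nr => dj; apply: reachable_frame.
  by rewrite -lt0n (leq_ltn_trans _ kn).
move: fullU; rewrite /U; case: asboolP => [/(_ di) //|_].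
by rewrite /row_full mxrank0 eq_sym (negPf di).
Qed.

End Necessity.

(** * Forests of basis vectors *)

Local Notation slot Q := (nat + arrow Q * nat)%type.

Section Forests.
Variables (Q : quiver) (n : dimvec Q).

(* [inl f] is the [f]-th framing vector; [inr (a, l)] is the image under [a] of
   the [l]-th basis vector at [src a]. *)
Definition slots (e : dimvec Q) (i : vertex Q) : seq (slot Q) :=
  [seq inl f | f <- iota 0 (n i)] ++
  [seq inr (a, l) | a <- enum [pred a : arrow Q | tgt a == i],
                    l <- iota 0 (e (src a))].

Lemma slots_inl (e : dimvec Q) (i : vertex Q) (f : nat) :
  (inl f \in slots e i) = (f < n i)%N.
Proof.
rewrite mem_cat mem_map; last by move=> ? ? [].
rewrite mem_iota /= add0n; apply/orb_idr => /allpairsPdep[a [l [_ _]]] //.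
Qed.

Lemma slots_inr (e : dimvec Q) (i : vertex Q) (a : arrow Q) (l : nat) :
  (inr (a, l) \in slots e i) = (tgt a == i) && (l < e (src a))%N.
Proof.
rewrite mem_cat; apply/orP/andP => [[/mapP[] //|]|[ai le]].
  move=> /allpairsPdep[b [k [bi ke [-> ->]]]].
  by move: bi ke; rewrite mem_enum mem_iota.
by right; apply/allpairsPdep; exists a, l; rewrite mem_enum mem_iota.
Qed.

Lemma size_slots (e : dimvec Q) (i : vertex Q) :
  size (slots e i) = (n i + \sum_(a : arrow Q | tgt a == i) e (src a))%N.
Proof.
rewrite size_cat size_map size_iota size_allpairs_dep sumnE big_map.
by congr addn; rewrite big_enum /=; apply: eq_bigr => a _; rewrite size_iota.
Qed.

Lemma slots_uniq (e : dimvec Q) (i : vertex Q) : uniq (slots e i).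
Proof.
rewrite cat_uniq map_inj_uniq ?iota_uniq /=; last by move=> ? ? [].
apply/andP; split.
  by apply/hasPn => s /allpairsPdep[a [l [_ _ ->]]]; apply/mapP => -[].
apply: allpairs_uniq_dep => [|a _|]; rewrite ?enum_uniq ?iota_uniq //.
by move=> [a l] [b k] _ _ /= [-> ->].
Qed.

Lemma sub_slots (e e' : dimvec Q) (i : vertex Q) :
  (forall j, e j <= e' j)%N -> {subset slots e i <= slots e' i}.
Proof.
move=> ee' [f|[a l]]; rewrite ?slots_inl // !slots_inr => /andP[-> le].
exact: leq_trans le (ee' _).
Qed.

Variables (e : dimvec Q) (par : vertex Q -> nat -> slot Q).

(** A vector taken from the framing has no parent, so the inner premise is vacuous there: these are
    the base cases. *)
Definition parent_closed (P : vertex Q -> nat -> Prop) : Prop :=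
  forall i k, (k < e i)%N ->
    (forall a l, par i k = inr (a, l) -> P (src a) l) -> P i k.

(* [par i k] is the origin of the [k]-th basis vector at [i]; [forest_ind]
   expresses that the parent relation is well founded. *)
Record forest : Prop := Forest {
  forest_slot : forall i k, (k < e i)%N -> par i k \in slots e i;
  forest_inj : forall i k l, (k < e i)%N -> (l < e i)%N ->
    par i k = par i l -> k = l;
  forest_ind : forall P : vertex Q -> nat -> Prop, parent_closed P ->
    forall i k, (k < e i)%N -> P i k }.

End Forests.

Section ForestGrowth.
Variables (Q : quiver) (n e : dimvec Q) (par : vertex Q -> nat -> slot Q).
Hypothesis forest_e : forest n e par.

(** Each basis vector over [T] has its parent over [T] again, since no framing lives there;
    well-foundedness forbids such a descent. *)
Lemma forest_frame (m : nat) (T : pred (vertex Q)) :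
  (0 < m)%N -> (forall i, T i -> e i = m) ->
  (forall i, T i -> n i = 0%N) ->
  (forall a : arrow Q, T (tgt a) -> e (src a) != 0%N -> T (src a)) ->
  forall i, ~~ T i.
Proof.
move=> m_gt0 Te Tn Tsrc i; apply/negP => Ti.
have : (0 < e i)%N by rewrite Te.
move/(forest_ind forest_e (P := fun i _ => ~~ T i)) => nT.
suff : ~~ T i by rewrite Ti.
apply: nT => {Ti}i k ke IH; apply/negP => Ti.
move: (forest_slot forest_e ke) IH; case: (par i k) => [f|[a l]].
  by rewrite slots_inl Tn.
rewrite slots_inr => /andP[/eqP ai la] /(_ a l erefl)/negP; apply.
by apply: Tsrc; rewrite ?ai // -lt0n (leq_ltn_trans _ la).
Qed.

Lemma forest_extend (i : vertex Q) :
  (e i < n i + \sum_(a : arrow Q | tgt a == i) e (src a))%N ->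
  exists par' : vertex Q -> nat -> slot Q,
    forest n [ffun j => e j + (j == i)]%N par'.
Proof.
move=> e_lt; set e' : dimvec Q := [ffun j => _].
have ee' j : (e j <= e' j)%N by rewrite ffunE leq_addr.
(* Pigeonhole: the slots at [i] are distinct and outnumber the [e i] vectors already placed. *)
have [s si sfresh] :
    exists2 s, s \in slots n e i & s \notin [seq par i k | k <- iota 0 (e i)].
  apply/hasP; rewrite has_predC; apply: contraL e_lt => /allP sub.
  rewrite -leqNgt -size_slots -[leqRHS](size_iota 0) -(size_map (par i)).
  exact: uniq_leq_size (slots_uniq _ _ _) sub.
pose par' j k := if (j == i) && (k == e i) then s else par j k.
have par'_old j k : (k < e j)%N -> par' j k = par j k.
  by rewrite /par'; case: eqP => // ->; case: eqP => // ->; rewrite ltnn.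
have par'_new : par' i (e i) = s by rewrite /par' !eqxx.
have e'P j k : (k < e' j)%N -> (k < e j)%N \/ j = i /\ k = e i.
  rewrite ffunE; case: eqP => [->|_]; last by rewrite addn0; left.
  by rewrite addn1 ltnS leq_eqVlt => /orP[/eqP ->|]; [right|left].
exists par'; split.
- move=> j k /e'P[ke|[-> ->]]; last by rewrite par'_new; apply: sub_slots si.
  by rewrite par'_old //; exact: sub_slots ee' _ (forest_slot forest_e ke).
- have old k : (k < e i)%N -> par i k <> s.
    by move=> ke /esym def_s; case/mapP: sfresh; exists k; rewrite // mem_iota.
  move=> j k l /e'P[ke|[-> ->]] /e'P[].
  + by move=> le; rewrite !par'_old //; exact: (forest_inj forest_e).
  + by move=> [ji ->]; move: ke; rewrite ji => ke; rewrite par'_new par'_old // => /old.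
  + by move=> le; rewrite par'_new par'_old // => /esym/old.
  + by move=> [_ ->].
- move=> P Pclosed.
  (* Parents of old vectors are old, so the old induction applies; the new vector, whose parent, if
     any, is old, comes last. *)
  have Pold j k : (k < e j)%N -> P j k.
    apply: (forest_ind forest_e) => {}j {}k ke IH; apply: Pclosed.
      exact: leq_trans ke (ee' _).
    by rewrite par'_old.
  move=> j k ke'; case: (e'P _ _ ke') => [/Pold //|[ji ki]].
  apply: Pclosed => // a l; rewrite ji ki par'_new => def_s.
  by move: si; rewrite def_s slots_inr => /andP[_ /Pold].
Qed.

End ForestGrowth.

(** * Existence of a forest of dimension vector [d] *)

Section ForestExists.
Variables (Q : quiver) (d n : dimvec Q).
Hypothesis dim_le : forall i : vertex Q,
  (d i <= n i + \sum_(a : arrow Q | tgt a == i) d (src a))%N.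
Hypothesis reach : forall (i : vertex Q) (di : d i != 0%N), reachable n di.

Lemma forest_growable (e : dimvec Q) (par : vertex Q -> nat -> slot Q) :
  forest n e par -> (exists i : vertex Q, e i < d i)%N ->
  exists2 i : vertex Q, (e i < d i)%N &
    (e i < n i + \sum_(a : arrow Q | tgt a == i) e (src a))%N.
Proof.
move=> forest_e [i0 i0S]; apply: contrapT => stuck.
have {}stuck i : (e i < d i)%N ->
    (n i + \sum_(a : arrow Q | tgt a == i) e (src a) <= e i)%N.
  by move=> id; rewrite leqNgt; apply/negP => ie; apply: stuck; exists i.
have le_sum (a : arrow Q) : (e (src a) <= \sum_(b : arrow Q | tgt b == tgt a) e (src b))%N.
  by rewrite (bigD1 a) //= leq_addr.
case: (arg_minnP (P := fun i => (e i < d i)%N) e i0S) => i1 i1S e_min.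
pose T : pred (vertex Q) := fun i => (e i < d i)%N && (e i == e i1).
have Ti1 : T i1 by rewrite /T i1S eqxx.
have [e0|e_gt0] := posnP (e i1).
  suff : ~~ T i1 by rewrite Ti1.
  have di1 : d i1 != 0%N by rewrite -lt0n (leq_ltn_trans _ i1S).
  apply: (reachable_ind (P := fun i => ~~ T i) _ _ (reach di1)).
    move=> i _; apply: contraNN => /andP[/stuck + /eqP ei]; lia.
  (* Here [e] is 0 at [tgt a], so [stuck] forces [e (src a)] to be 0 as well, hence below
     [d (src a)]. *)
  move=> a da _; apply: contraNN => /andP[/stuck + /eqP ea].
  by rewrite /T; have := le_sum a; lia.
suff Tpred i : T i -> n i = 0%N /\
    forall a, tgt a = i -> e (src a) != 0%N -> T (src a).
  suff : ~~ T i1 by rewrite Ti1.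
  apply: (forest_frame forest_e e_gt0) => [i /andP[_ /eqP]|i /Tpred[]|a] //.
  by move=> /Tpred[_]; apply.
move=> /andP[iS /eqP ei]; have := stuck _ iS.
(* Otherwise [d] is at most [e] at all sources, and [dim_le] with [stuck] would give
   [d i <= e i]. *)
have [b /eqP bi bS] : exists2 b : arrow Q, tgt b == i & (e (src b) < d (src b))%N.
  apply: contrapT => nob; move: (iS); apply/negP; rewrite -leqNgt.
  apply: leq_trans (dim_le i) _; apply: leq_trans (stuck _ iS).
  rewrite leq_add2l; apply: leq_sum => a ai; rewrite leqNgt; apply/negP => aS.
  by apply: nob; exists a.
(* By minimality [e (src b)] is at least [e i], so [b] alone uses up the bound from [stuck]: [n i]
   and the terms of all other arrows vanish. *)
have := e_min _ bS; rewrite (bigD1 b) ?bi //= => eb sum_le; split; first by lia.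
move=> a ai; have [->|ab] := eqVneq a b; first by rewrite /T bS; lia.
move: sum_le; rewrite (bigD1 a) ?ai ?eqxx //=; lia.
Qed.

Lemma forest_exists : exists par, forest n d par.
Proof.
(* Induction on the total dimension [m]; [e <= d] with equal totals forces [e = d]. *)
suff grow m : (m <= \sum_i d i)%N -> exists (e : dimvec Q) par,
    [/\ forest n e par, forall i, (e i <= d i)%N & \sum_i e i = m].
  have [e [par [forest_e ed sum_e]]] := grow _ (leqnn _).
  suff <- : e = d by exists par.
  have [_] := leqif_sum (P := predT) (fun i _ => leqif_eq (ed i)).
  by rewrite sum_e eqxx => /esym/forallP e_eq; apply/ffunP => i; apply/eqP/e_eq.
elim: m => [_|m IHm m_lt].
  exists [ffun=> 0%N], (fun _ _ => inl 0%N); split.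
  - by split=> [i k|i k l|P _ i k]; rewrite ffunE.
  - by move=> i; rewrite ffunE.
  - by rewrite big1 // => i; rewrite ffunE.
have [e [par [forest_e ed sum_e]]] := IHm (ltnW m_lt).
have [|i id ie] := forest_growable forest_e.
  apply: contrapT => noi; move: m_lt; apply/negP; rewrite -leqNgt -sum_e.
  by apply: leq_sum => i _; rewrite leqNgt; apply/negP => ie; apply: noi; exists i.
have [par' forest_e'] := forest_extend forest_e ie.
exists [ffun j => e j + (j == i)]%N, par'; split=> // [j|].
  by rewrite ffunE; case: eqP => [->|_]; rewrite ?addn1 ?addn0.
rewrite (eq_bigr (fun j => e j + (j == i)))%N => [|j _]; last by rewrite ffunE.
rewrite big_split /= sum_e -addn1 (bigD1 i) //= eqxx big1 // => j.
by case: eqP.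
Qed.

End ForestExists.

(** * The representation carried by a forest *)

Section TreeRep.
Variables (F : fieldType) (Q : quiver) (d n : dimvec Q).
Variable par : vertex Q -> nat -> slot Q.
Hypothesis forest_d : forest n d par.

(** Each slot is sent to the basis vector originating in it, or to 0 if there is none. *)
Definition tree_rep : framed_rep F d n := FramedRep
  (fun a => \matrix_(l, k) (par (tgt a) k == inr (a, l : nat))%:R)
  (fun i => \matrix_(f, k) (par i k == inl (f : nat))%:R).

(** Injectivity of [par] brings a basis vector to the shape of a row of [tree_rep]. *)
Lemma delta_parent (i : vertex Q) (k : 'I_(d i)) :
  delta_mx 0 k = \row_q (par i q == par i k)%:R :> 'rV[F]_(d i).
Proof.
apply/rowP => q; rewrite !mxE eqxx /=.
suff -> : (par i q == par i k) = (q == k) by [].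
apply/eqP/eqP => [|-> //].
by move/(forest_inj forest_d (ltn_ord q) (ltn_ord k))/val_inj.
Qed.

Lemma tree_rep_generated : generated tree_rep.
Proof.
move=> U subU frU i; rewrite -sub1mx; apply/row_subP => k; rewrite row1.
(* [forest_ind] ranges over natural numbers; quantifying over [q] of value [l] keeps bound proofs
   out of [P]. *)
pose P j l := forall q : 'I_(d j),
  q = l :> nat -> ((delta_mx 0 q : 'rV[F]_(d j)) <= U j)%MS.
suff Pall j l : (l < d j)%N -> P j l by exact: Pall (ltn_ord k) k erefl.
apply: (forest_ind forest_d) => {}j {}l _ IH q def_l.
move: (forest_slot forest_d (ltn_ord q)) IH; rewrite delta_parent -{}def_l.
case: (par j q) => [f|[a m]].
  rewrite slots_inl => fn _; apply: submx_trans (frU j).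
  suff -> : \row_p (par j p == inl f)%:R = row (Ordinal fn) (rep_frame tree_rep j).
    exact: row_sub.
  by apply/rowP => p; rewrite !mxE.
rewrite slots_inr => /andP[/eqP aj md] /(_ a m erefl (Ordinal md) erefl) am.
case: j / aj q => q; apply: submx_trans (subU a).
suff -> : \row_p (par (tgt a) p == inr (a, m))%:R =
          delta_mx 0 (Ordinal md) *m rep_arrow tree_rep a.
  exact: submxMr.
by rewrite -rowE; apply/rowP => p; rewrite !mxE.
Qed.

End TreeRep.

Theorem theorem6p1 (R : realType) (Q : quiver) (d n : dimvec Q) (n_neq0 : n != 0) :
  (hilb R[i] d n !=set0) <->
  (forall i : vertex Q, 0 <= (n i)%:Z - euler d (unitvec i)) /\
  (forall (i : vertex Q) (di : d i != 0%N),
     exists (j : vertex Q) (dj : d j != 0%N),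
       n j != 0%N /\
       exists p : seq (arrow (supp d)),
         is_qpath (exist _ j dj : vertex (supp d)) p
                  (exist _ i di : vertex (supp d))).
Proof.
split=> [[_ [x xgen _]]|[dim_le reach]].
  split=> [i|i di]; first by rewrite euler_condE (generated_dim_le xgen).
  exact: (generated_reachable xgen di).
have [par forest_d] : exists par, forest n d par.
  by apply: forest_exists reach => i; rewrite -euler_condE.
exists (base_orbit (tree_rep R[i] d n par)), (tree_rep R[i] d n par) => //.
exact: tree_rep_generated forest_d.
Qed.
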